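(* Let $k\ge 1$, let $\pi_\beta$ be a strictly positive, continuously differentiable density on $\mathbb{R}^k$ that is sub-exponentially light, and suppose there exist $\alpha>k$ and $R<\infty$ such that $$\frac{\beta}{|\beta|}\cdot\nabla\log\pi_\beta(\beta)\le-\frac{\alpha}{|\beta|},\qquad |\beta|>R.$$ Let $b>0$, define $f:[0,\infty)\to[0,\infty)$ by $f(x)=e^{bx}-\frac{e}{3}$ for $x>\frac1b$ and $f(x)=x^3\frac{b^3e}{6}+x\frac{be}{2}$ for $x\le\frac1b$, and define $h:\mathbb{R}^k\to\mathbb{R}^k$ by $h(\gamma)=f(|\gamma|)\,\gamma/|\gamma|$ for $\gamma\ne0$ and $h(0)=0$. Then the density $$\pi_\gamma(\gamma)=\pi_\beta\bigl(h(\gamma)\bigr)\,\bigl|\det\nabla h(\gamma)\bigr|,\qquad \gamma\in\mathbb{R}^k,$$ is exponentially light.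
   Context: $|\cdot|$ denotes the Euclidean norm on $\mathbb{R}^k$, and $\cdot$ between vectors the inner product; $e$ is the base of the natural logarithm. Densities are with respect to Lebesgue measure. $\nabla h(\gamma)$ is the Jacobian matrix of $h$. For a strictly positive continuously differentiable density $\pi$ on $\mathbb{R}^k$ consider $$L(\pi)=\limsup_{|x|\to\infty}\frac{x}{|x|}\cdot\nabla\log\pi(x)\in[-\infty,\infty].$$ $\pi$ is called super-exponentially light if $L(\pi)=-\infty$, exponentially light if $L(\pi)<0$ (the value $-\infty$ is allowed), and sub-exponentially light if $L(\pi)=0$. *)

(* Defs.v *)
(* MathComp-Analysis; R^k is 'rV[R]_k for R : realType. *)
From HB Require Import structures.
From mathcomp Require Import all_boot all_order all_algebra.
From mathcomp Require Import all_classical all_reals all_analysis.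

Set Implicit Arguments.
Unset Strict Implicit.
Unset Printing Implicit Defensive.

Import Order.TTheory GRing.Theory Num.Theory.
Import numFieldNormedType.Exports.

Local Open Scope classical_set_scope.
Local Open Scope ring_scope.

(* The library norms 'rV[R]_k with the sup norm, hence [enorm]; both norms
   give the same topology and the same derivatives. *)
Definition dotv {R : realType} {k : nat} (u v : 'rV[R]_k) : R :=
  \sum_(i < k) u 0 i * v 0 i.

Definition enorm {R : realType} {k : nat} (u : 'rV[R]_k) : R :=
  Num.sqrt (dotv u u).

(* u / |u|; since 0^-1 = 0 in the library, unitv 0 = 0. *)
Definition unitv {R : realType} {k : nat} (u : 'rV[R]_k) : 'rV[R]_k :=
  (enorm u)^-1 *: u.

(* The filter |x| --> +oo. *)
Definition enorm_pinfty {R : realType} {k : nat} : set_system 'rV[R]_k :=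
  filter_from [set: R] (fun M => [set x | M < enorm x]).

Definition grad {R : realType} {k : nat} (p : 'rV[R]_k -> R) (x : 'rV[R]_k) :
    'rV[R]_k :=
  \row_(i < k) 'D_('e_i) p x.

Definition cont_diff {R : realType} {k : nat} (p : 'rV[R]_k -> R) : Prop :=
  (forall x, differentiable p x) /\ continuous (grad p).

(* Lebesgue measure on R^k as the iterated product of the Lebesgue measure
   of R, on k-tuples with their product sigma-algebra; see [lebesgue_rn_box]. *)
Fixpoint lebesgue_rn (R : realType) (k : nat) :
    set (k.-tuple (measurableTypeR R)) -> \bar R :=
  match k with
  | 0 => dirac [tuple]
  | n.+1 => pushforward (@lebesgue_measure R \x @lebesgue_rn R n)%E
       (fun xt : measurableTypeR R * n.-tuple (measurableTypeR R) =>
          [tuple of xt.1 :: xt.2])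
  end.
Arguments lebesgue_rn : clear implicits.

Lemma measurable_cons_pair (R : realType) (n : nat) :
  measurable_fun [set: (measurableTypeR R * n.-tuple (measurableTypeR R))%type]
    (fun xt => [tuple of xt.1 :: xt.2]).
Proof. exact: (measurable_cons measurable_fst measurable_snd). Qed.

Lemma measurable_uncons (R : realType) (n : nat) :
  measurable_fun [set: n.+1.-tuple (measurableTypeR R)]
    (fun t => (thead t, [tuple of behead t])).
Proof.
apply: measurable_fun_pair; last exact: measurable_behead.
exact: measurable_tnth.
Qed.

Section lebesgue_rn_step.
Context (R : realType) (n : nat).
Variable mu : {sigma_finite_measure set (n.-tuple (measurableTypeR R)) -> \bar R}.

Let c (xt : measurableTypeR R * n.-tuple (measurableTypeR R)) :=
  [tuple of xt.1 :: xt.2].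

Let step := pushforward (@lebesgue_measure R \x mu)%E c.

HB.instance Definition _ := Measure.copy step
  (measure_function_pushforward__canonical__measure_function_Measure
     (@lebesgue_measure R \x mu)%E (@measurable_cons_pair R n)).

Let step_sigma_finite : sigma_finite setT step.
Proof.
pose d (t : n.+1.-tuple (measurableTypeR R)) := (thead t, [tuple of behead t]).
have cK : d \o c = id.
  by apply/funext => -[x t]; rewrite /d /c/=; congr pair; exact/val_inj.
have /sigma_finiteP[F [TF ndF Foo]] := sigma_finiteT (@lebesgue_measure R).
have /sigma_finiteP[G [TG ndG Goo]] := sigma_finiteT mu.
exists (fun i => d @^-1` (F i `*` G i)).
  apply/esym; rewrite -preimage_bigcup -subTset => t _ /=.
  have [i _ Fi] : (\bigcup_i F i) (d t).1 by rewrite -TF.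
  have [j _ Gj] : (\bigcup_i G i) (d t).2 by rewrite -TG.
  exists (maxn i j) => //; split.
    by move: Fi; exact/subsetPset/ndF/leq_maxl.
  by move: Gj; exact/subsetPset/ndG/leq_maxr.
move=> i; have [mF Fi] := Foo i; have [mG Gi] := Goo i; split.
  rewrite -[X in measurable X]setTI.
  by apply: measurable_uncons => //; exact: measurableX.
rewrite /step /pushforward -comp_preimage cK preimage_id.
by rewrite product_measure1E// lte_mul_pinfty// ge0_fin_numE.
Qed.

HB.instance Definition _ := Measure_isSigmaFinite.Build _ _ _ step
  step_sigma_finite.

Lemma lebesgue_rn_step :
  exists nu : {sigma_finite_measure set (n.+1.-tuple (measurableTypeR R)) -> \bar R},
    nu = step :> (set _ -> \bar R).
Proof. by exists step. Qed.

End lebesgue_rn_step.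

Lemma lebesgue_rn_sigma_finite_measure (R : realType) (k : nat) :
  exists mu : {sigma_finite_measure set (k.-tuple (measurableTypeR R)) -> \bar R},
    mu = lebesgue_rn R k :> (set _ -> \bar R).
Proof.
elim: k => [|n [mu IH]] /=; first by exists (dirac [tuple]).
by rewrite -IH; exact: lebesgue_rn_step.
Qed.

Section lebesgue_rn_measure.
Local Open Scope ereal_scope.
Context (R : realType) (k : nat).

Let lebesgue_rn0 : lebesgue_rn R k set0 = 0.
Proof. by have [mu <-] := lebesgue_rn_sigma_finite_measure R k. Qed.

Let lebesgue_rn_ge0 A : 0 <= lebesgue_rn R k A.
Proof. by have [mu <-] := lebesgue_rn_sigma_finite_measure R k. Qed.

Let lebesgue_rn_semi_sigma_additive : semi_sigma_additive (lebesgue_rn R k).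
Proof.
have [mu <-] := lebesgue_rn_sigma_finite_measure R k.
exact: measure_semi_sigma_additive.
Qed.

HB.instance Definition _ := isMeasure.Build _ _ _ (lebesgue_rn R k)
  lebesgue_rn0 lebesgue_rn_ge0 lebesgue_rn_semi_sigma_additive.

Let lebesgue_rn_sigma_finite : sigma_finite setT (lebesgue_rn R k).
Proof.
have [mu <-] := lebesgue_rn_sigma_finite_measure R k.
exact: (sigma_finiteT mu).
Qed.

HB.instance Definition _ := Measure_isSigmaFinite.Build _ _ _ (lebesgue_rn R k)
  lebesgue_rn_sigma_finite.

End lebesgue_rn_measure.

Lemma lebesgue_rn_box (R : realType) (k : nat)
    (A : 'I_k -> set (measurableTypeR R)) :
  (forall i, measurable (A i)) ->
  lebesgue_rn R k [set t | forall i, A i (tnth t i)] =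
  (\prod_(i < k) lebesgue_measure (A i))%E.
Proof.
elim: k A => [|n IH] A mA /=.
  rewrite big_ord0 diracE (_ : [set _ | _] = setT) ?in_setT//.
  by rewrite -subTset => t _ [].
rewrite big_ord_recl -IH => [|i]; last exact: mA.
rewrite -product_measure1E; last 2 first.
- exact: mA.
- rewrite (_ : [set _ | _] = \bigcap_(i : 'I_n) (@tnth _ _ ^~ i @^-1` A (lift ord0 i))).
    apply: fin_bigcap_measurable => // i _.
    by rewrite -[X in measurable X]setTI; apply: measurable_tnth.
  by apply/seteqP; split => t /= h i; [move=> _; exact: h|exact: h].
rewrite /pushforward; congr product_measure1.
apply/seteqP; split => -[x t] /=.
  by move=> h; split=> [|i]; [exact: (h ord0)|have := h (lift ord0 i); rewrite tnthS].
by move=> [hx ht] i; case: (unliftP ord0 i) => [j ->|->]//; rewrite tnthS.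
Qed.

Definition row_of_tuple {R : realType} {k : nat} (t : k.-tuple R) : 'rV[R]_k :=
  \row_(i < k) tnth t i.

Definition is_density {R : realType} {k : nat} (p : 'rV[R]_k -> R) : Prop :=
  [/\ measurable_fun [set: k.-tuple (measurableTypeR R)]
        (fun t => p (row_of_tuple t) : measurableTypeR R),
      forall x, 0 <= p x
    & (\int[lebesgue_rn R k]_t (p (row_of_tuple t))%:E = 1)%E].

Definition positive_C1_density {R : realType} {k : nat} (p : 'rV[R]_k -> R) :
    Prop :=
  [/\ is_density p, forall x, 0 < p x & cont_diff p].

Definition light_limsup {R : realType} {k : nat} (p : 'rV[R]_k -> R) : \bar R :=
  limf_esup (fun x => (dotv (unitv x) (grad (fun y => ln (p y)) x))%:E) enorm_pinfty.

Definition exponentially_light {R : realType} {k : nat} (p : 'rV[R]_k -> R) :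
    Prop :=
  (light_limsup p < 0)%E.

Definition sub_exponentially_light {R : realType} {k : nat}
    (p : 'rV[R]_k -> R) : Prop :=
  light_limsup p = 0%E.

(* Only the values at x >= 0 are used. *)
Definition radial_f {R : realType} (b x : R) : R :=
  if b^-1 < x then expR (b * x) - expR 1 / 3
  else x ^+ 3 * (b ^+ 3 * expR 1 / 6) + x * (b * expR 1 / 2).

Definition radial_h {R : realType} {k : nat} (b : R) (g : 'rV[R]_k) :
    'rV[R]_k :=
  if g == 0 then 0 else radial_f b (enorm g) *: unitv g.

(* [jacobian] acts on row vectors, so it is the transpose of the usual Jacobian
   matrix; the determinant is the same. *)
Definition transformed_density {R : realType} {k : nat} (p : 'rV[R]_k -> R)
    (h : 'rV[R]_k -> 'rV[R]_k) (g : 'rV[R]_k) : R :=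
  p (h g) * `|\det (jacobian h g)|.

(* Main.v *)
Require Import Defs.
From HB Require Import structures.
From mathcomp Require Import all_boot all_order all_algebra.
From mathcomp Require Import all_classical all_reals all_analysis.
From mathcomp Require Import measurable_realfun.
From mathcomp Require Import ring lra.
Import Order.TTheory GRing.Theory Num.Theory.
Import numFieldNormedType.Exports.
Local Open Scope classical_set_scope.
Local Open Scope ring_scope.

(** The map [h] is radial: [h x = G(|x|^2) x] for a scalar profile [G] of class
    C^1 on the whole real line, the two branches of [f] agreeing to second order
    at [x = 1/b].  Writing [D(s) = G(s) + 2 s G'(s)], which is [f'(|x|)] at
    [s = |x|^2], the Jacobian matrix of [h] is the rank-one perturbation
    [G I + 2 G' x^T x] of a scalar matrix, so its determinant is [D G^(k-1)],
    which is positive.  As [D] is again of class C^1, the new density is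
    [p(h x) D(s) G(s)^(k-1)] with [s = |x|^2]; it is positive and of class C^1.

    It has total mass one because [h] maps every line through the origin to
    itself, which reduces the change of variables to one dimension.
    Integrating over [R^k] along the lines spanned by the vectors
    [(1, z)], [z] in [R^(k-1)], gives ([ge0_integral_lines])
      [\int F = \int_z \int_t |t|^(k-1) F(t (1, z)) dt dz],
    which follows from Tonelli and the scaling of Lebesgue measure on
    [R^(k-1)].  On one line, [h] is [t y |-> q(t) y] with [q(t) = t G(t^2 |y|^2)]
    and [q' = D], so that [|t|^(k-1) D G^(k-1) = q' |q|^(k-1)], and substitution
    in one variable finishes the computation
    ([integral_line_transformed]).

    For the tail, let [r = |x| > 1/b] and [A = e^(br) - e/3 = |h x|].  The radial
    derivative of the logarithm of the new density is
      [D * (radial derivative of ln p at h x) + 2 r (D'/D + (k-1) G'/G)],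
    where [2 r D'/D = b], [2 r G'/G = b e^(br)/A - 1/r] and [D = b e^(br)].
    The hypothesis on [p] bounds the first summand by [- alpha b e^(br)/A], hence
    the total is at most [(k - 1 - alpha) b e^(br)/A + b <= - (alpha - k) b < 0]
    ([light_numeric]). *)

Set Implicit Arguments.
Unset Strict Implicit.
Unset Printing Implicit Defensive.

(** * Integration along lines through the origin *)

Section lebesgue_scaling.
Context {R : realType}.
Notation mu := (@lebesgue_measure R).
Notation rn := (lebesgue_rn R).

(** The preimage is half-open on the other side when [c < 0], hence the existential. *)
Lemma preimage_mul_itv (c a b : R) : c != 0 ->
  exists i : interval R,
  ( *%R c) @^-1` `]a, b]%classic = [set` i] /\
  lebesgue_measure [set` i] = (if a < b then `|c|^-1 * (b - a) else 0)%:E.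
Proof.
rewrite neq_lt => /orP[c0|c0].
- exists `[b / c, a / c[; split.
    apply/seteqP; split => x /=; rewrite !in_itv/= ltr_ndivlMr// ler_ndivrMr// mulrC.
      by rewrite andbC.
    by rewrite andbC.
  rewrite lebesgue_measure_itv/= lte_fin ltr_ndivlMr// divfK ?lt_eqF//.
  case: ifP => // _; rewrite ltr0_norm// -EFinB -mulrBl; congr EFin.
  by field; rewrite lt_eqF.
- exists `]a / c, b / c]; split.
    by apply/seteqP; split => x /=; rewrite !in_itv/= ler_pdivlMr// ltr_pdivrMr// mulrC.
  rewrite lebesgue_measure_itv/= lte_fin ltr_pdivlMr// divfK ?gt_eqF//.
  case: ifP => // _; rewrite gtr0_norm// -EFinB -mulrBl; congr EFin.
  by rewrite mulrC.
Qed.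

(** Up to the factor [`|c|], the image of Lebesgue measure under multiplication
    by [c] gives every half-open interval its length, and such a measure is
    unique. *)
Lemma ge0_integral_scale (c : R) (f : measurableTypeR R -> \bar R) : c != 0 ->
  measurable_fun [set: measurableTypeR R] f -> (forall x, 0 <= f x)%E ->
  (\int[mu]_t f t = `|c|%:E * \int[mu]_t f (c * t)%R)%E.
Proof.
move=> c0 mf f0.
have mc : measurable_fun [set: measurableTypeR R]
   ( *%R c : _ -> measurableTypeR R) by exact: mulrl_measurable.
pose nu := pushforward mu ( *%R c : measurableTypeR R -> measurableTypeR R).
pose c' := NngNum (normr_ge0 c).
pose m1 : {measure set (measurableTypeR R) -> \bar R} :=
  measure_function_pushforward__canonical__measure_function_Measure mu mc.
have E : forall A, measurable A -> mu A = mscale c' m1 A.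
  apply: lebesgue_measure_unique => _ [[a b]] _ <-.
  have [i [Ei Li]] := preimage_mul_itv a b c0.
  change (mu `]a, b]%classic = (`|c|%:E * mu (( *%R c) @^-1` `]a, b]%classic))%E).
  rewrite Ei [X in (_ * X)%E]Li.
  rewrite lebesgue_measure_itv/= lte_fin -EFinM; case: ifP => //; last by rewrite mulr0.
  by rewrite mulrA divff ?normr_eq0// mul1r EFinB.
transitivity (\int[mscale c' m1]_t f t)%E.
  by apply: eq_measure_integral => A mA _; exact: E.
rewrite ge0_integral_mscale//=; congr (_ * _)%E.
by rewrite /m1/= /nu ge0_integral_pushforward.
Qed.

Lemma integral_rnS n (f : n.+1.-tuple (measurableTypeR R) -> \bar R) :
  measurable_fun setT f -> (forall x, 0 <= f x)%E ->
  (\int[rn n.+1]_x f x = \int[mu]_t \int[rn n]_x f [tuple of t :: x])%E.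
Proof.
move=> mf f0.
have mc := @measurable_cons_pair R n.
pose g (z : measurableTypeR R * n.-tuple (measurableTypeR R)) :=
  f [tuple of z.1 :: z.2].
transitivity (\int[mu \x rn n]_z g z)%E.
  by rewrite [LHS](ge0_integral_pushforward mc (mu \x rn n)%E).
rewrite (fubini_tonelli1 g)//; last by move=> z; exact: f0.
exact: measurableT_comp.
Qed.

Definition tscale n (c : R) (x : n.-tuple (measurableTypeR R)) :
  n.-tuple (measurableTypeR R) := [tuple c * tnth x i | i < n].

Lemma tscale_cons n c t (x : n.-tuple (measurableTypeR R)) :
  tscale c [tuple of t :: x] = [tuple of (c * t : measurableTypeR R) :: tscale c x].
Proof.
apply: eq_from_tnth => i; rewrite tnth_mktuple.
by case: (unliftP ord0 i) => [j ->|->]; rewrite ?tnthS ?tnth0// tnth_mktuple.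
Qed.

Lemma measurable_tscale d (T : measurableType d) n (c : T -> measurableTypeR R)
    (x : T -> n.-tuple (measurableTypeR R)) :
  measurable_fun setT c -> measurable_fun setT x ->
  measurable_fun setT (fun z => tscale (c z) (x z)).
Proof.
move=> mc mx; apply/measurable_fun_tnthP => i.
rewrite (_ : _ \o _ = fun z => c z * tnth (x z) i); last first.
  by apply/funext => z /=; rewrite tnth_mktuple.
apply: measurable_funM => //.
exact: (measurableT_comp (@measurable_tnth _ _ _ i)).
Qed.

(** Each coordinate contributes one factor [`|c|]. *)
Lemma ge0_integral_tscale n (c : R) (f : n.-tuple (measurableTypeR R) -> \bar R) :
  c != 0 -> measurable_fun setT f -> (forall x, 0 <= f x)%E ->
  (\int[rn n]_x f x = (`|c| ^+ n)%:E * \int[rn n]_x f (tscale c x))%E.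
Proof.
move=> c0; elim: n f => [|n IH] f mf f0.
  rewrite expr0 mul1e; apply: eq_integral => x _; congr f.
  by rewrite (tuple0 x) (tuple0 (tscale _ _)).
have mfs : measurable_fun [set: n.+1.-tuple (measurableTypeR R)]
    (fun x => f (tscale c x)).
  by apply: measurableT_comp => //; exact: measurable_tscale.
have mcons (t : measurableTypeR R) : measurable_fun
   [set: n.-tuple (measurableTypeR R)] (fun x => [tuple of t :: x]).
  exact: measurable_cons.
have mF : measurable_fun [set: measurableTypeR R]
     (fun t => \int[rn n]_x f [tuple of t :: x])%E.
  apply: (@measurable_fun_fubini_tonelli_F _ _ _ _ _ (rn n)
     (fun z : measurableTypeR R * _ => f [tuple of z.1 :: z.2])) => //.
  by apply: measurableT_comp => //; exact: measurable_cons_pair.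
rewrite !integral_rnS// (ge0_integral_scale c0)//; last first.
  by move=> t; apply: integral_ge0.
rewrite exprS EFinM -muleA; congr (_ * _)%E.
rewrite -ge0_integralZl//; last 2 first.
- apply: (@measurable_fun_fubini_tonelli_F _ _ _ _ _ (rn n)
     (fun z : measurableTypeR R * _ => f (tscale c [tuple of z.1 :: z.2]))) => //.
  by apply: (measurableT_comp mfs); exact: measurable_cons_pair.
- by move=> t _; apply: integral_ge0.
apply: eq_integral => t _; rewrite IH//.
- by congr (_ * _)%E; apply: eq_integral => x _; rewrite tscale_cons.
- by apply: measurableT_comp => //; exact: mcons.
Qed.

Definition affine_dir n (z : n.-tuple (measurableTypeR R)) :
  n.+1.-tuple (measurableTypeR R) := [tuple of (1 : measurableTypeR R) :: z].

(** A replacement for polar coordinates.  For fixed [t != 0], the substitution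
    [x' = t z] in the last [n] coordinates of the point [(t, x') = t (1, z)] has
    Jacobian [`|t| ^+ n]; exchanging the two integrals then integrates first
    along the line spanned by [(1, z)].  The lines inside the hyperplane [t = 0]
    are missed, but they form a null set. *)
Lemma ge0_integral_lines n (f : n.+1.-tuple (measurableTypeR R) -> \bar R) :
  measurable_fun setT f -> (forall x, 0 <= f x)%E ->
  (\int[rn n.+1]_x f x =
   \int[rn n]_z \int[mu]_t ((`|t| ^+ n)%:E * f (tscale t (affine_dir z))))%E.
Proof.
move=> mf f0.
pose F (w : measurableTypeR R * n.-tuple (measurableTypeR R)) :=
  ((`|w.1| ^+ n)%:E * f (tscale w.1 (affine_dir w.2)))%E.
have mF : measurable_fun setT F.
  apply: emeasurable_funM.
    apply/measurable_EFinP; apply: measurable_funX.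
    by apply: measurableT_comp => //; exact: measurable_fst.
  apply: measurableT_comp => //; apply: measurable_tscale => //.
  by apply: measurable_cons.
have F0 w : (0 <= F w)%E by rewrite mule_ge0// lee_fin exprn_ge0.
rewrite integral_rnS// -(fubini_tonelli F)//.
have mG : measurable_fun [set: measurableTypeR R]
     (fun t => \int[rn n]_x f [tuple of t :: x])%E.
  apply: (@measurable_fun_fubini_tonelli_F _ _ _ _ _ (rn n)
     (fun z : measurableTypeR R * _ => f [tuple of z.1 :: z.2])) => //.
  by apply: measurableT_comp => //; exact: measurable_cons_pair.
have mH : measurable_fun [set: measurableTypeR R]
     (fun t => \int[rn n]_x F (t, x))%E.
  exact: (@measurable_fun_fubini_tonelli_F _ _ _ _ _ (rn n) F).
(* The substitution in the inner integral fails at [t = 0], a null set. *)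
have m0 : measurable ([set: R] `\ 0) by exact: measurableD.
rewrite -(@integral_setD1 _ (fun t => \int[rn n]_x f [tuple of t :: x])%E 0)//; last first.
  exact: measurable_funS mG.
rewrite -[RHS](@integral_setD1 _ (fun t => \int[rn n]_x F (t, x))%E 0)//; last first.
  exact: measurable_funS mH.
apply: eq_integral => t; rewrite inE/= => -[_ /eqP t0].
rewrite (ge0_integral_tscale t0)//; last first.
  by apply: measurableT_comp => //; exact: measurable_cons.
have mt : measurable_fun [set: n.-tuple (measurableTypeR R)]
    (fun x => f [tuple of t :: tscale t x]).
  apply: (measurableT_comp mf); apply: measurable_cons => //.
  exact: measurable_tscale.
rewrite -ge0_integralZl//.
apply: eq_integral => x _.
by rewrite /F/= /affine_dir tscale_cons mulr1.
Qed.

End lebesgue_scaling.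

(** * Substitution on the real line *)

Section line_substitution.
Context {R : realType}.
Notation mu := (@lebesgue_measure R).

Lemma is_derive_continuous (q dq : R -> R) :
  (forall x : R, is_derive x 1 q (dq x)) -> continuous q.
Proof.
move=> dq' x; apply/differentiable_continuous/derivable1_diffP.
by have [] := dq' x.
Qed.

Lemma bigcup_exhaust (q : R -> R) : {homo q : x y / x <= y} ->
  q x @[x --> -oo] --> -oo -> q x @[x --> +oo] --> +oo ->
  \bigcup_m `[q (- m%:R), q m%:R]%classic = [set: R].
Proof.
move=> qh qN qP; rewrite -subTset => y _.
have /cvgryPge/(_ y)[M [_ HM]] := qP.
have /cvgrNyPle/(_ y)[N [_ HN]] := qN.
pose m := Num.truncn (`|M| + `|N|).
have mlt : `|M| + `|N| < m.+1%:R by exact: Num.Theory.truncnS_gt.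
exists m.+1 => //=; rewrite in_itv/=; apply/andP; split.
  apply: HN; rewrite ltrNl (le_lt_trans _ mlt)//.
  by rewrite (le_trans (ler_norm _))// normrN lerDr.
by apply: HM; rewrite (le_lt_trans _ mlt)// (le_trans (ler_norm _))// lerDl.
Qed.

(** The derivative [dq] may be unbounded at infinity, as it is for the
    exponential profile below.  The equality therefore comes from substitution
    on the compact intervals [[-m, m]] and monotone convergence, the images
    [[q (-m), q m]] exhausting the line. *)
Lemma ge0_integration_by_substitution_line (q dq phi : R -> R) :
  {homo q : x y / x < y} -> (forall x : R, is_derive x 1 q (dq x)) ->
  continuous dq ->
  q x @[x --> -oo] --> -oo -> q x @[x --> +oo] --> +oo ->
  continuous phi -> (forall x, 0 <= phi x) ->
  (\int[mu]_x (phi x)%:E = \int[mu]_x (phi (q x) * dq x)%:E)%E.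
Proof.
move=> qh dq' cdq qN qP cphi phi0.
have qd x : derivable q x 1 by have [] := dq' x.
have qE : derive1 q = dq by apply/funext => x; rewrite derive1E; have [] := dq' x.
have cq : continuous q := is_derive_continuous dq'.
have qle : {homo q : x y / x <= y} by move=> x y; rewrite le_eqVlt => /predU1P[->//|/qh/ltW].
have dq0 x : 0 <= dq x.
  by rewrite -qE; apply: (@incr_derive1_ge0 _ _ setT) => //; [move=> ? ? _ _; exact: qh|rewrite interiorT].
pose psi x := phi (q x) * dq x.
have cpsi : continuous psi.
  by move=> x; apply: cvgM; [apply: continuous_comp; [exact: cq|exact: cphi]|exact: cdq].
have psi0 x : 0 <= psi x by rewrite mulr_ge0.
have ndA (f : R -> R) : {homo f : x y / x <= y} ->
    nondecreasing_seq (fun m => `[f (- m%:R), f m%:R]%classic : set R).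
  move=> fh m n mn; apply/subsetPset => x /=; rewrite !in_itv/= => /andP[x1 x2].
  rewrite (le_trans _ x1) ?(le_trans x2)//; apply: fh; rewrite ?lerN2 ler_nat//.
have key (f g : R -> R) : {homo f : x y / x <= y} ->
    f x @[x --> -oo] --> -oo -> f x @[x --> +oo] --> +oo ->
    continuous g -> (forall x, 0 <= g x) ->
    (\int[mu]_(x in `[f (- m%:R)%R, f m%:R]) (g x)%:E @[m --> \oo] -->
    \int[mu]_x (g x)%:E)%E.
  move=> fh fN fP cg g0; rewrite -(bigcup_exhaust fh fN fP).
  apply: ge0_nondecreasing_set_cvg_integral => //.
  - exact: ndA.
  - move=> m; apply: measurable_funTS; apply/measurable_EFinP.
    exact: continuous_measurable_fun.
  - by move=> m x _; rewrite lee_fin.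
have := key q phi qle qN qP cphi phi0.
have := key id psi (fun _ _ => id) (fun _ => id) (fun _ => id) cpsi psi0.
move=> /cvg_lim <-//; move=> /cvg_lim <-//; congr (limn _); apply/funext => m.
rewrite integration_by_substitution_increasing.
- by rewrite qE.
- by rewrite lerNl -subr_ge0 opprK addr_ge0.
- by move=> x y _ _; exact: qh.
- by move=> x _; rewrite qE; exact: cdq.
- by rewrite qE; apply/cvg_ex; eexists; apply: cvg_at_right_filter; exact: cdq.
- by rewrite qE; apply/cvg_ex; eexists; apply: cvg_at_left_filter; exact: cdq.
- split; [by move=> x _|by apply: cvg_at_right_filter; exact: cq|by apply: cvg_at_left_filter; exact: cq].
- exact: continuous_subspaceT.
Qed.

End line_substitution.

(** * Gluing functions at a point *)

Section gluing.
Context {R : realType}.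

Definition glue {T : Type} (c : R) (f1 f2 : R -> T) (s : R) : T :=
  if c < s then f2 s else f1 s.

Lemma cvg_if {T : Type} (F : set_system T) (FF : Filter F) (P : T -> bool)
    (u v : T -> R) (l : R) :
  u @ F --> l -> v @ F --> l -> (fun x => if P x then u x else v x) @ F --> l.
Proof.
move=> /cvgrPdist_lt ul /cvgrPdist_lt vl; apply/cvgrPdist_lt => e e0.
by apply: filterS2 (ul e e0) (vl e e0) => x ux vx; case: ifP.
Qed.

Lemma continuous_glue (c : R) (f1 f2 : R -> R) : f1 c = f2 c ->
  (forall s, s <= c -> {for s, continuous f1}) ->
  (forall s, c <= s -> {for s, continuous f2}) -> continuous (glue c f1 f2).
Proof.
move=> fc c1 c2 s; have [sc|cs|sc] := ltgtP s c.
- rewrite /continuous_at /glue (lt_gtF sc).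
  apply: cvg_trans (c1 _ (ltW sc)); apply: near_eq_cvg.
  by near=> x; rewrite lt_gtF//; near: x; exact: lt_nbhsl.
- rewrite /continuous_at /glue cs.
  apply: cvg_trans (c2 _ (ltW cs)); apply: near_eq_cvg.
  by near=> x; rewrite ifT//; near: x; exact: lt_nbhsr.
- rewrite /continuous_at {2}/glue sc ltxx; apply: cvg_if; last exact: c1.
  by rewrite fc; exact: c2.
Unshelve. all: by end_near. Qed.

(** At the junction, the difference quotient of the glued function is at each
    increment one of the two given quotients, and both have the same limit. *)
Lemma is_derive_glue (c : R) (f1 f2 d1 d2 : R -> R) :
  f1 c = f2 c -> d1 c = d2 c ->
  (forall s, s <= c -> is_derive s 1 f1 (d1 s)) ->
  (forall s, c <= s -> is_derive s 1 f2 (d2 s)) ->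
  forall s : R, is_derive s 1 (glue c f1 f2) (glue c d1 d2 s).
Proof.
move=> fc dc D1 D2 s; have [sc|cs|->] := ltgtP s c.
- rewrite {2}/glue (lt_gtF sc).
  apply: near_eq_is_derive (D1 _ (ltW sc)).
  by near=> x; rewrite /glue lt_gtF//; near: x; exact: lt_nbhsl.
- rewrite {2}/glue cs.
  apply: near_eq_is_derive (D2 _ (ltW cs)).
  by near=> x; rewrite /glue ifT//; near: x; exact: lt_nbhsr.
- have q1 := D1 c (lexx c); have q2 := D2 c (lexx c).
  rewrite {2}/glue ltxx.
  have Q1 : h^-1 *: (f1 (h *: 1 + c) - f1 c) @[h --> 0^'] --> d1 c.
    by have [/cvg_ex[l /= L] <-] := q1; move: (L) => /cvg_lim; rewrite /derive /= => ->.
  have Q2 : h^-1 *: (f2 (h *: 1 + c) - f2 c) @[h --> 0^'] --> d1 c.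
    by rewrite dc; have [/cvg_ex[l /= L] <-] := q2; move: (L) => /cvg_lim; rewrite /derive /= => ->.
  have Q : h^-1 *: (glue c f1 f2 (h *: 1 + c) - glue c f1 f2 c) @[h --> 0^'] --> d1 c.
    rewrite [X in X @ _ --> _](_ : _ = fun h => if c < h *: 1 + c then
      h^-1 *: (f2 (h *: 1 + c) - f2 c) else h^-1 *: (f1 (h *: 1 + c) - f1 c)).
      exact: cvg_if.
    by apply/funext => h; rewrite /glue ltxx; case: ifP => // _; rewrite fc.
  by apply: DeriveDef; [apply/cvg_ex; exists (d1 c)|exact: cvg_lim Q].
Unshelve. all: by end_near. Qed.

End gluing.

(** * The profile of the radial map *)

Section profile.
Context {R : realType}.
Variable b : R.
Hypothesis b0 : 0 < b.
Let e : R := expR 1.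
Let E (s : R) : R := expR (b * Num.sqrt s).

(** The value of [|x|^2] at which [radial_f] changes formula. *)
Definition cut : R := b^-1 ^+ 2.

(** [f(r)/r] as a function of [s = r^2].  In this variable the inner branch is
    affine, so that [h] is visibly a polynomial map around the origin. *)
Definition ratio : R -> R :=
  glue cut (fun s => s * (b ^+ 3 * e / 6) + b * e / 2)
           (fun s => (E s - e / 3) / Num.sqrt s).
Definition dratio : R -> R :=
  glue cut (fun=> b ^+ 3 * e / 6)
    (fun s => (b * Num.sqrt s * E s - E s + e / 3) / (2 * Num.sqrt s ^+ 3)).
(** [f'(r)] as a function of [s = r^2]. *)
Definition slope : R -> R :=
  glue cut (fun s => s * (b ^+ 3 * e / 2) + b * e / 2) (fun s => b * E s).
Definition dslope : R -> R :=
  glue cut (fun=> b ^+ 3 * e / 2) (fun s => b ^+ 2 * E s / (2 * Num.sqrt s)).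

Let bN0 : b != 0. Proof. by rewrite gt_eqF. Qed.
Let e0 : 0 < e. Proof. exact: expR_gt0. Qed.

Lemma cut_gt0 : 0 < cut. Proof. by rewrite exprn_gt0// invr_gt0. Qed.

Lemma sqrt_cut : Num.sqrt cut = b^-1.
Proof. by rewrite sqrtr_sqr gtr0_norm// invr_gt0. Qed.

Let E_cut : E cut = e. Proof. by rewrite /E sqrt_cut mulfV. Qed.

Let sq0 s : cut <= s -> Num.sqrt s != 0.
Proof. by move=> cs; rewrite gt_eqF// sqrtr_gt0 (lt_le_trans cut_gt0). Qed.

Let dE s : cut <= s -> is_derive s 1 E (b * E s / (2 * Num.sqrt s)).
Proof.
move=> cs; have s0 : 0 < s := lt_le_trans cut_gt0 cs.
have ds := is_derive1_sqrt s0.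
have dm : is_derive s 1 (b \*: Num.sqrt) (b *: (2 * Num.sqrt s)^-1).
  exact: is_deriveZ.
rewrite (_ : _ / _ = expR ((b \*: Num.sqrt) s) * (b *: (2 * Num.sqrt s)^-1)).
  exact: (@is_derive1_comp _ expR (b \*: Num.sqrt) s).
by rewrite /E /= /GRing.scale/= mulrA (mulrC _ b).
Qed.

Lemma is_derive_ratio (s : R) : is_derive s 1 ratio (dratio s).
Proof.
apply: is_derive_glue.
- by rewrite E_cut sqrt_cut /cut; field.
- by rewrite E_cut sqrt_cut /cut; field.
- move=> t _; apply: is_derive_eq.
  by rewrite /GRing.scale/=; ring.
- move=> t ct; have dEt := dE ct.
  have ds := is_derive1_sqrt (lt_le_trans cut_gt0 ct).
  have dV := @is_deriveV _ _ _ _ _ (sq0 ct) ds.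
  apply: is_derive_eq; rewrite /GRing.scale/=; field.
  exact: sq0.
Qed.

Lemma is_derive_slope (s : R) : is_derive s 1 slope (dslope s).
Proof.
apply: is_derive_glue.
- by rewrite E_cut /cut; field.
- by rewrite E_cut sqrt_cut; field.
- by move=> t _; apply: is_derive_eq; rewrite /GRing.scale/=; ring.
- move=> t ct; have dEt := dE ct.
  apply: is_derive_eq; rewrite /GRing.scale/=; field.
  exact: sq0.
Qed.

Let cE s : {for s, continuous E}.
Proof.
apply: continuous_comp; last exact: continuous_expR.
by apply: cvgM; [exact: cvg_cst|exact: sqrt_continuous].
Qed.

Lemma continuous_dratio : continuous dratio.
Proof.
apply: continuous_glue.
- by rewrite E_cut sqrt_cut; field.
- by move=> s _; exact: cvg_cst.
- move=> s cs.
  have c1 := @sqrt_continuous R s.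
  apply: cvgM.
    apply: cvgD; last exact: cvg_cst.
    apply: cvgB; last exact: cE.
    apply: cvgM; last exact: cE.
    by apply: cvgM => //; exact: cvg_cst.
  apply: cvgV; first by rewrite mulf_neq0// expf_neq0// sq0.
  apply: cvgM; first exact: cvg_cst.
  by apply: cvgM => //; apply: cvgM.
Qed.

Lemma continuous_dslope : continuous dslope.
Proof.
apply: continuous_glue.
- by rewrite E_cut sqrt_cut; field.
- by move=> s _; exact: cvg_cst.
- move=> s cs.
  have c1 := @sqrt_continuous R s.
  apply: cvgM.
    by apply: cvgM; [exact: cvg_cst|exact: cE].
  apply: cvgV; first by rewrite mulf_neq0// sq0.
  by apply: cvgM; first exact: cvg_cst.
Qed.

(** This is [f' = (r g)'] for [g = f/r], written in the variable [s = r^2]. *)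
Lemma slopeE s : slope s = ratio s + 2 * s * dratio s.
Proof.
rewrite /slope /ratio /dratio /glue; case: ifPn => [cs|_]; last by field.
have s0 : 0 <= s by rewrite ltW// (lt_trans cut_gt0).
have := sqr_sqrtr s0; have := sq0 (ltW cs).
set r := Num.sqrt s => rN0 rs; rewrite -[in X in _ = _ + 2 * X * _]rs; field.
exact: rN0.
Qed.

Lemma slope_gt0 s : 0 <= s -> 0 < slope s.
Proof.
move=> s0; rewrite /slope /glue; case: ifP => _; first by rewrite mulr_gt0 ?expR_gt0.
rewrite ltr_wpDl ?divr_gt0 ?mulr_gt0// mulr_ge0// ltW// divr_gt0// mulr_gt0//.
exact: exprn_gt0.
Qed.

(** On the outer branch, [e^(br) >= e b r] by convexity of the exponential, and
    [e b r >= e], so that [e^(br) - e/3 >= 2/3 e b r]. *)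
Lemma ratio_ge s : 0 <= s -> b * e / 2 <= ratio s.
Proof.
move=> s0; rewrite /ratio /glue; case: ifPn => [cs|_]; last first.
  by rewrite lerDr mulr_ge0// ltW// divr_gt0// mulr_gt0// exprn_gt0.
have r0 : 0 < Num.sqrt s by rewrite sqrtr_gt0 (lt_trans cut_gt0).
have br1 : 1 <= b * Num.sqrt s.
  by rewrite mulrC -ler_pdivrMr// div1r -sqrt_cut ler_wsqrtr// ltW.
have : e * (b * Num.sqrt s) <= E s.
  rewrite /E -[X in expR X](subrKC 1) expRD ler_pM2l//.
  by rewrite (le_trans _ (expR_ge1Dx _))// subrKC.
rewrite ler_pdivlMr//; move: br1; set X := b * Num.sqrt s => X1 HE.
rewrite (_ : b * e / 2 * Num.sqrt s = e * X / 2); last by rewrite /X; ring.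
have : e <= e * X by rewrite ler_peMr// ltW.
have := e0; move: HE; move: (e * X) (E s) => u v; lra.
Qed.

Lemma ratio_gt0 s : 0 <= s -> 0 < ratio s.
Proof. by move=> s0; rewrite (lt_le_trans _ (ratio_ge s0))// divr_gt0// mulr_gt0. Qed.

Lemma radial_hE k (g : 'rV[R]_k) : radial_h b g = ratio (dotv g g) *: g.
Proof.
rewrite /radial_h; case: eqVneq => [->|gN0]; first by rewrite scaler0.
rewrite /unitv scalerA; congr (_ *: _).
have d0 : 0 <= dotv g g by apply: sumr_ge0 => i _; rewrite -expr2 sqr_ge0.
have dN0 : 0 < dotv g g.
  rewrite lt_neqAle d0 andbT eq_sym; apply: contra gN0 => /eqP dg0.
  apply/eqP/rowP => i; rewrite mxE; apply/eqP; rewrite -sqrf_eq0 expr2.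
  have /psumr_eq0P/(_ i isT)-> // := dg0.
  by move=> j _; rewrite -expr2 sqr_ge0.
rewrite /radial_f /ratio /glue -sqrt_cut ltr_sqrt// -/e.
have rs := sqr_sqrtr d0; rewrite /enorm -/(E _).
case: ifP => // _.
have rN0 : Num.sqrt (dotv g g) != 0 by rewrite gt_eqF// sqrtr_gt0.
rewrite -[X in _ = X * _ + _]rs; field.
exact: rN0.
Qed.

End profile.

(** * Calculus on row vectors *)

Section row_calculus.
Context {R : realType} {k : nat}.
Notation V := ('rV[R]_k).

Lemma is_derive_diff (U W : normedModType R) (f : U -> W) x v :
  differentiable f x -> is_derive x v f ('D_v f x).
Proof. by move=> df; apply: DeriveDef => //; exact: diff_derivable. Qed.

Lemma is_derive_coord (x v : V) i : is_derive x v (fun y : V => y 0 i) (v 0 i).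
Proof.
have dc : differentiable (fun y : V => y 0 i) x by exact: differentiable_coord.
apply: DeriveDef; first exact: diff_derivable.
have := @derive_mx _ _ 1 k (id : V -> V) x v (@derivable_id _ _ x v).
by rewrite derive_id => /(congr1 (fun M : V => M 0 i)); rewrite mxE => ->.
Qed.

Lemma derive_comp_real (phi : R -> R) (dphi : R) (g : V -> R) (x v : V) :
  is_derive (g x) 1 phi dphi -> differentiable g x ->
  differentiable (phi \o g) x /\ 'D_v (phi \o g) x = dphi * 'D_v g x.
Proof.
move=> [dp dpE] dg; have dphi' : differentiable phi (g x) by exact/derivable1_diffP.
have dc : differentiable (phi \o g) x by exact: differentiable_comp.
split=> //; rewrite !deriveE//= diff_comp//= diff1E//= derive1E dpE mulrC.
by rewrite /GRing.scale.
Qed.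

Lemma dotvE (u v : V) : dotv u v = (u *m v^T) 0 0.
Proof. by rewrite mxE; apply: eq_bigr => i _; rewrite !mxE. Qed.

Lemma dotvZl (a : R) (u v : V) : dotv (a *: u) v = a * dotv u v.
Proof. by rewrite /dotv mulr_sumr; apply: eq_bigr => i _; rewrite mxE mulrA. Qed.

Lemma dotvZr (a : R) (u v : V) : dotv u (a *: v) = a * dotv u v.
Proof. by rewrite /dotv mulr_sumr; apply: eq_bigr => i _; rewrite mxE mulrCA. Qed.

Lemma dotvC (u v : V) : dotv u v = dotv v u.
Proof. by apply: eq_bigr => i _; rewrite mulrC. Qed.

Lemma sq_ge0 (x : V) : 0 <= dotv x x.
Proof. by apply: sumr_ge0 => i _; rewrite -expr2 sqr_ge0. Qed.

Lemma is_derive_sq (x v : V) :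
  is_derive x v (fun y : V => dotv y y) (2 * dotv x v).
Proof.
rewrite (_ : (fun y : V => _) = \sum_(i < k) ((fun y : V => y 0 i) * (fun y : V => y 0 i))).
  have D i : is_derive x v ((fun y : V => y 0 i) * (fun y : V => y 0 i))
     (x 0 i *: v 0 i + x 0 i *: v 0 i).
    by apply: is_deriveM; exact: is_derive_coord.
  apply: is_derive_eq; rewrite /dotv mulr_sumr; apply: eq_bigr => i _.
  by rewrite /GRing.scale/=; ring.
by apply/funext => y; rewrite fct_sumE.
Qed.

Lemma differentiable_sq (x : V) : differentiable (fun y : V => dotv y y) x.
Proof.
rewrite (_ : (fun y : V => _) = \sum_(i < k) ((fun y : V => y 0 i) * (fun y : V => y 0 i))).
  apply: differentiable_sum => i; apply: differentiableM; exact: differentiable_coord.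
by apply/funext => y; rewrite fct_sumE.
Qed.

Lemma differentiable_row (f : V -> V) x :
  (forall i, differentiable (fun y => f y 0 i) x) -> differentiable f x.
Proof.
move=> df; rewrite (_ : f = \sum_(i < k) (fun y => f y 0 i *: 'e_i)).
  by apply: differentiable_sum => i; exact: differentiableZl.
by apply/funext => y; rewrite fct_sumE -row_sum_delta.
Qed.

Lemma continuous_row (T : topologicalType) (f : T -> V) :
  (forall i, continuous (fun y => f y 0 i)) -> continuous f.
Proof.
move=> cf; rewrite (_ : f = fun y => \sum_(i < k) f y 0 i *: 'e_i).
  apply: continuous_big => [z|i _ x]; first exact: add_continuous.
  by apply: cvgZ; [exact: cf|exact: cvg_cst].
by apply/funext => y; rewrite -row_sum_delta.
Qed.

Lemma derive_grad (p : V -> R) (x v : V) : differentiable p x ->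
  'D_v p x = dotv (grad p x) v.
Proof.
move=> dp; rewrite deriveE// {1}(row_sum_delta v) linear_sum; apply: eq_bigr => i _.
by rewrite linearZ/= mxE deriveE// mulrC.
Qed.

(** The block matrix [M1] becomes block triangular both after a column and after
    a row operation; the two resulting determinants are the two sides. *)
Lemma det_scalar_rank1 n (a : R) (u v : 'rV[R]_n.+1) : a != 0 ->
  \det (a%:M + u^T *m v) = (a + dotv v u) * a ^+ n.
Proof.
move=> a0.
pose M1 := block_mx (1%:M : 'M[R]_1) v (- u^T) (a%:M : 'M[R]_n.+1).
have E1 : M1 *m block_mx 1%:M (- v) 0 1%:M
   = block_mx 1%:M 0 (- u^T) (a%:M + u^T *m v).
  rewrite mulmx_block !mulmx1 !mul1mx !mulmx0 !addr0 mulNmx mulmxN opprK.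
  by rewrite addNr addrC.
have E2 : block_mx 1%:M (- (a^-1 *: v)) 0 1%:M *m M1
   = block_mx (1%:M + a^-1 *: (v *m u^T)) 0 (- u^T) a%:M.
  rewrite mulmx_block !mul1mx !mul0mx !add0r mulNmx mulmxN opprK.
  by rewrite mulNmx mul_mx_scalar -scalemxAl scalerA divff// scale1r subrr.
have := congr1 determinant E1; have := congr1 determinant E2.
rewrite !det_mulmx !det_ublock !det_lblock !det1 !mul1r mulr1 => -> <-.
rewrite det_scalar det_mx11 !mxE eqxx/= exprS mulrA; congr (_ * _).
rewrite mulrDl mul1r mulrC mulrA divff// mul1r; congr (_ + _).
by apply: eq_bigr => i _; rewrite !mxE.
Qed.

End row_calculus.

(** * The Jacobian of the radial map and the transformed density *)

Section radial_map.
Context {R : realType} {n : nat}.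
Notation V := ('rV[R]_n.+1).
Variable b : R.
Hypothesis b0 : 0 < b.
Notation h := (@radial_h R n.+1 b).

Lemma radial_h_fun : h = fun x => ratio b (dotv x x) *: x.
Proof. by apply/funext => x; rewrite radial_hE. Qed.

Lemma derive_profile (phi dphi : R -> R) (x v : V) :
  (forall s : R, is_derive s 1 phi (dphi s)) ->
  differentiable (fun y : V => phi (dotv y y)) x /\
  'D_v (fun y : V => phi (dotv y y)) x = dphi (dotv x x) * (2 * dotv x v).
Proof.
move=> dp.
have [d1 d2] := @derive_comp_real _ _ phi _ (fun y : V => dotv y y) x v (dp (dotv x x)) (differentiable_sq x).
by split=> //; rewrite [LHS]d2; have [_ ->] := is_derive_sq x v.
Qed.

Let radial_coord (x v : V) i :
  differentiable (fun y => h y 0 i) x /\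
  'D_v (fun y => h y 0 i) x =
    (ratio b (dotv x x) *: v + (2 * dotv x v * dratio b (dotv x x)) *: x) 0 i.
Proof.
rewrite (_ : (fun y => _) = (fun y : V => ratio b (dotv y y)) * (fun y : V => y 0 i)).
  have [d1 d2] := derive_profile x v (is_derive_ratio b0).
  have dc : differentiable (fun y : V => y 0 i) x by exact: differentiable_coord.
  split; first exact: differentiableM.
  have := is_deriveM (is_derive_diff v d1) (is_derive_coord x v i).
  by move=> [_ ->]; rewrite d2 !mxE /GRing.scale/=; ring.
by apply/funext => y; rewrite radial_h_fun mxE.
Qed.

Lemma differentiable_radial (x : V) : differentiable h x.
Proof. by apply: differentiable_row => i; have [] := radial_coord x 0 i. Qed.

Lemma derive_radial (x v : V) :
  'D_v h x = ratio b (dotv x x) *: v + (2 * dotv x v * dratio b (dotv x x)) *: x.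
Proof.
rewrite derive_mx; last exact/diff_derivable/differentiable_radial.
by apply/rowP => i; rewrite mxE; have [_ ->] := radial_coord x v i.
Qed.

(** The Jacobian determinant of [h] at [x], as a function of [s = |x|^2]. *)
Definition weight (s : R) : R := slope b s * ratio b s ^+ n.
Definition dweight (s : R) : R :=
  dslope b s * ratio b s ^+ n + slope b s * (n%:R * ratio b s ^+ n.-1 * dratio b s).

Lemma det_jacobian_radial (x : V) : \det (jacobian h x) = weight (dotv x x).
Proof.
rewrite (_ : jacobian h x = (ratio b (dotv x x))%:M +
   ((2 * dratio b (dotv x x)) *: x)^T *m x).
  rewrite det_scalar_rank1 ?gt_eqF ?ratio_gt0 ?sq_ge0//.
  congr (_ * _); rewrite slopeE//; congr (_ + _).
  rewrite /dotv mulr_sumr mulr_suml; apply: eq_bigr => i _; rewrite !mxE; ring.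
apply/row_matrixP => i; rewrite !rowE -deriveEjacobian; last exact: differentiable_radial.
rewrite derive_radial mulmxDr mul_mx_scalar mulmxA; congr (_ + _).
rewrite [X in X *m _]mx11_scalar mul_scalar_mx -dotvE; congr (_ *: _).
by rewrite dotvZr (dotvC x); ring.
Qed.

Lemma weight_gt0 s : 0 <= s -> 0 < weight s.
Proof. by move=> s0; rewrite mulr_gt0 ?slope_gt0// exprn_gt0// ratio_gt0. Qed.

Lemma is_derive_weight (s : R) : is_derive s 1 weight (dweight s).
Proof.
have d1 := is_derive_slope b0 s; have d2 := is_derive_ratio b0 s.
rewrite (_ : weight = slope b * (ratio b) ^+ n).
  apply: is_derive_eq; rewrite /GRing.scale/= /dweight exprfctE.
  by rewrite addrC (mulrC (dslope b s)).
by apply/funext => t; rewrite /weight exprfctE.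
Qed.

Lemma transformed_densityE (p : V -> R) x :
  transformed_density p h x = p (h x) * weight (dotv x x).
Proof.
by rewrite /transformed_density det_jacobian_radial gtr0_norm// weight_gt0// sq_ge0.
Qed.

Lemma derive_transformed (p : V -> R) (x v : V) : (forall y, differentiable p y) ->
  differentiable (transformed_density p h) x /\
  'D_v (transformed_density p h) x =
   dotv (grad p (h x)) ('D_v h x) * weight (dotv x x)
   + p (h x) * (dweight (dotv x x) * (2 * dotv x v)).
Proof.
move=> dp.
rewrite (_ : transformed_density p h = (p \o h) * (fun x => weight (dotv x x))); last first.
  by apply/funext => y; rewrite transformed_densityE.
have [w1 w2] := derive_profile x v is_derive_weight.
have dh := differentiable_radial x.
have dph : differentiable (p \o h) x by exact: differentiable_comp.
split; first exact: differentiableM.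
have [_ ->] := is_deriveM (is_derive_diff v dph) (is_derive_diff v w1).
have E : 'D_v (p \o h) x = dotv (grad p (h x)) ('D_v h x).
  rewrite (deriveE v dph) (diff_comp dh (dp _)) /= -(deriveE v dh).
  by rewrite -(derive_grad _ (dp _)) (deriveE _ (dp _)).
by rewrite E w2 /GRing.scale/= addrC; congr (_ + _); rewrite mulrC.
Qed.

Lemma continuous_dotv (T : topologicalType) (f g : T -> V) :
  continuous f -> continuous g -> continuous (fun x => dotv (f x) (g x)).
Proof.
move=> cf cg; apply: continuous_big => [z|i _ x]; first exact: add_continuous.
by apply: cvgM; apply: (@cvg_comp _ _ _ _ (fun y : V => y 0 i));
  [exact: cf|exact: coord_continuous|exact: cg|exact: coord_continuous].
Qed.

Lemma continuous_profile (phi : R -> R) : continuous phi ->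
  continuous (fun x : V => phi (dotv x x)).
Proof.
move=> cphi x; apply: (@continuous_comp _ _ _ (fun x : V => dotv x x) phi); last exact: cphi.
by apply: continuous_dotv => ?; exact: cvg_id.
Qed.

Lemma continuous_ratio : continuous (ratio b).
Proof. exact: is_derive_continuous (is_derive_ratio b0). Qed.

Lemma continuous_slope : continuous (slope b).
Proof. exact: is_derive_continuous (is_derive_slope b0). Qed.

Lemma continuous_weight : continuous weight.
Proof. exact: is_derive_continuous is_derive_weight. Qed.

Lemma continuous_dweight : continuous dweight.
Proof.
have cX m (f : R -> R) : continuous f -> continuous (fun s => f s ^+ m).
  move=> cf s; apply: (@continuous_comp _ _ _ f (fun x => x ^+ m)); first exact: cf.
  exact: exprn_continuous.
move=> s; apply: cvgD; apply: cvgM.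
- exact: continuous_dslope.
- exact: (cX _ _ continuous_ratio).
- exact: continuous_slope.
- apply: cvgM; last exact: continuous_dratio.
  by apply: cvgM; [exact: cvg_cst|exact: (cX _ _ continuous_ratio)].
Qed.

Lemma cont_diff_transformed (p : V -> R) : cont_diff p ->
  cont_diff (transformed_density p h).
Proof.
move=> [dp cg]; split=> [x|]; first by have [] := derive_transformed x 0 dp.
have ch : continuous h by move=> x; exact/differentiable_continuous/differentiable_radial.
apply: continuous_row => i.
rewrite (_ : (fun y => _) = (fun x => dotv (grad p (h x)) ('D_('e_i) h x) * weight (dotv x x)
   + p (h x) * (dweight (dotv x x) * (2 * dotv x 'e_i)))); last first.
  by apply/funext => x; rewrite mxE; have [_ ->] := derive_transformed x 'e_i dp.
have cid : continuous (fun x : V => x) by move=> ?; exact: cvg_id.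
have ce : continuous (fun _ : V => 'e_i : V) by exact: cst_continuous.
have cd : continuous (fun x : V => dotv x 'e_i).
  exact: (continuous_dotv cid ce).
have cgh : continuous (grad p \o h).
  by move=> y; apply: (@continuous_comp _ _ _ h (grad p)); [exact: ch|exact: cg].
have cr := continuous_profile continuous_ratio.
have cdr := continuous_profile (continuous_dratio b0).
have c2d : continuous (fun x : V => 2 * dotv x 'e_i).
  by move=> y; apply: (cvgM (cvg_cst (2 : R)) (cd y)).
have cdh : continuous (fun x => 'D_('e_i) h x).
  rewrite (_ : (fun x => _) = fun x => ratio b (dotv x x) *: 'e_i +
     (2 * dotv x 'e_i * dratio b (dotv x x)) *: x); last first.
    by apply/funext => y; rewrite derive_radial.
  move=> y.
  exact: (cvgD (cvgZ (cr y) (ce y)) (cvgZ (cvgM (c2d y) (cdr y)) (cid y))).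
have c1 : continuous (fun x => dotv (grad p (h x)) ('D_('e_i) h x)).
  exact: (continuous_dotv cgh cdh).
have c2 := continuous_profile continuous_weight.
have c3 : continuous (p \o h).
  move=> y; apply: (@continuous_comp _ _ _ h p); first exact: ch.
  exact: differentiable_continuous.
have cdw := continuous_profile continuous_dweight.
have c4 : continuous (fun x : V => dweight (dotv x x) * (2 * dotv x 'e_i)).
  by move=> y; exact: (cvgM (cdw y) (c2d y)).
by move=> x; apply: (cvgD (cvgM (c1 x) (c2 x)) (cvgM (c3 x) (c4 x))).
Qed.

End radial_map.

(** * The tail of the transformed density *)

Section tail.
Context {R : realType}.

Lemma limf_esup_le (k : nat) (f : 'rV[R]_k -> R) (M c : R) :
  (forall x, M < enorm x -> f x <= c) ->
  (limf_esup (fun x => (f x)%:E) (@enorm_pinfty R k) <= c%:E)%E.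
Proof.
move=> fc; apply: (@le_trans _ _ (ereal_sup ((fun x => (f x)%:E) @` [set x | M < enorm x]))).
  by apply: ereal_inf_lbound; exists [set x | M < enorm x] => //; exists M.
by apply: ge_ereal_sup => _ [x Mx <-]; rewrite lee_fin; exact: fc.
Qed.

Lemma enormZ k (a : R) (u : 'rV[R]_k) : 0 <= a -> enorm (a *: u) = a * enorm u.
Proof.
move=> a0; rewrite /enorm dotvZl dotvZr mulrA -expr2 sqrtrM ?sqr_ge0//.
by rewrite sqrtr_sqr ger0_norm.
Qed.

Lemma dot_grad_ln k (p : 'rV[R]_k.+1 -> R) (x u : 'rV[R]_k.+1) :
  0 < p x -> differentiable p x ->
  dotv u (grad (fun y => ln (p y)) x) = (p x)^-1 * 'D_u p x.
Proof.
move=> p0 dp; have [d1 d2] := derive_comp_real u (is_derive1_ln p0) dp.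
by rewrite dotvC -derive_grad.
Qed.

(** The right-hand sides of the equations are the values of the profile, its
    slope and their derivatives at [s = r ^+ 2], on the outer branch, with
    [E = e^(br)]; [n] stands for [k - 1]. *)
Lemma light_numeric (b alpha n r E e G G1 D D1 L : R) :
  0 < b -> 0 < r -> 0 < e -> e < E -> 0 <= n -> n + 1 < alpha ->
  G = (E - e / 3) / r ->
  G1 = (b * r * E - E + e / 3) / (2 * r ^+ 3) ->
  D = b * E -> D1 = b ^+ 2 * E / (2 * r) ->
  L <= - (alpha / (G * r)) ->
  D * L + 2 * r * (D1 / D + n * G1 / G) <= - ((alpha - (n + 1)) * b).
Proof.
move=> b0 r0 e0 eE n0 na -> -> -> ->.
have A0 : 0 < E - e / 3 by lra.
have E0 : 0 < E by lra.
move: A0; set A := E - e / 3 => A0.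
have AE : A <= E by rewrite /A; lra.
rewrite divfK ?gt_eqF// => HL.
have H1 : b * E * L <= - (alpha * (b * (E / A))).
  rewrite (_ : - _ = b * E * - (alpha / A)); last by ring.
  by rewrite ler_pM2l// mulr_gt0.
have H2 : 2 * r * (b ^+ 2 * E / (2 * r) / (b * E) +
    n * ((b * r * E - E + e / 3) / (2 * r ^+ 3)) / (A / r)) =
    b + n * (b * (E / A)) - n / r.
  rewrite (_ : b * r * E - E + e / 3 = b * r * E - A); last by rewrite /A; ring.
  by field; rewrite !gt_eqF.
rewrite H2.
have H3 : b <= b * (E / A) by rewrite ler_peMr ?ler_pdivlMr ?mul1r// ltW.
have H4 : 0 <= n / r by rewrite divr_ge0// ltW.
move: H1 H3 H4; move: (b * (E / A)) (n / r) (b * E * L) => u v w H1 H3 H4.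
have : (alpha - n) * b <= (alpha - n) * u by rewrite ler_pM2l//; lra.
lra.
Qed.

(** [x] and [h x] have the same direction [u], and the derivative of [h] at [x]
    maps [u] to [slope b s *: u]: so only the radial derivative of [ln p] enters. *)
Lemma radial_derivative_ln_transformed (n : nat) (p : 'rV[R]_n.+1 -> R) (b : R)
  (x : 'rV[R]_n.+1) :
  0 < b -> (forall y, differentiable p y) -> (forall y, 0 < p y) -> 0 < enorm x ->
  let s := dotv x x in
  dotv (unitv x) (grad (fun y => ln (transformed_density p (radial_h b) y)) x) =
  slope b s * dotv (unitv (radial_h b x)) (grad (fun y => ln (p y)) (radial_h b x))
  + 2 * enorm x * (dslope b s / slope b s + n%:R * dratio b s / ratio b s).
Proof.
move=> b0 dp p0 r0 s.
have s0 : 0 <= s := sq_ge0 x.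
have rN0 : enorm x != 0 by rewrite gt_eqF.
have rs : enorm x * enorm x = s by rewrite -expr2 sqr_sqrtr.
have [dt dtE] := derive_transformed b0 x (unitv x) dp.
have G0 := ratio_gt0 b0 s0; have D0 := slope_gt0 b0 s0.
have W0 := @weight_gt0 _ n _ b0 _ s0.
have hu : unitv (radial_h b x) = unitv x.
  rewrite radial_hE// /unitv enormZ ?ltW// scalerA; congr (_ *: _).
  by rewrite invfM mulrAC mulVf ?mul1r// gt_eqF.
have xu : dotv x (unitv x) = enorm x.
  by rewrite dotvZr -/s -rs mulrA mulVf// mul1r.
have hD : 'D_(unitv x) (radial_h b) x = slope b s *: unitv x.
  rewrite derive_radial// xu slopeE// -/s scalerDl; congr (_ + _).
  rewrite /unitv scalerA; congr (_ *: _); rewrite -rs; field.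
  by [].
have t0 : 0 < transformed_density p (radial_h b) x.
  by rewrite transformed_densityE// mulr_gt0.
rewrite dot_grad_ln// dtE hu hD dotvZr xu dot_grad_ln// derive_grad//.
rewrite transformed_densityE// -/s.
move: (dotv (grad p _) _) => d.
have pN0 : p (radial_h b x) != 0 by rewrite gt_eqF.
rewrite /dweight.
have WE : @weight R n b s = slope b s * ratio b s ^+ n by [].
have DN0 : slope b s != 0 by rewrite gt_eqF.
have GN0 : ratio b s != 0 by rewrite gt_eqF.
have GE : n%:R * ratio b s ^+ n.-1 = n%:R * ratio b s ^+ n / ratio b s.
  case: (n) => [|m]; first by rewrite !mul0r.
  by rewrite exprS; field.
rewrite GE WE; field.
by rewrite pN0 DN0 GN0 expf_neq0.
Qed.

Lemma exponentially_light_transformed (n : nat) (p : 'rV[R]_n.+1 -> R)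
    (alpha R0 b : R) :
  (forall y, differentiable p y) -> (forall y, 0 < p y) ->
  n.+1%:R < alpha ->
  (forall y, R0 < enorm y ->
     dotv (unitv y) (grad (fun z => ln (p z)) y) <= - (alpha / enorm y)) ->
  0 < b -> exponentially_light (transformed_density p (radial_h b)).
Proof.
move=> dp p0 ka tail b0.
pose e : R := expR 1; have e0 : 0 < e by exact: expR_gt0.
have be0 : 0 < b * e / 2 by rewrite divr_gt0// mulr_gt0.
apply: (@le_lt_trans _ _ (- ((alpha - (n%:R + 1)) * b))%:E); last first.
  by rewrite lte_fin oppr_lt0 mulr_gt0// subr_gt0 natr1.
(* The first summand forces the outer branch; the second forces [R0 < |h x|],
   through the lower bound [b e / 2] for [ratio]. *)
apply: (@limf_esup_le _ _ (b^-1 + `|R0| / (b * e / 2))) => x Mx.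
have M1 : b^-1 < enorm x.
  by rewrite (le_lt_trans _ Mx)// lerDl divr_ge0// ltW.
have M2 : `|R0| < enorm x * (b * e / 2).
  by rewrite -ltr_pdivrMr// (le_lt_trans _ Mx)// lerDr invr_ge0 ltW.
have r0 : 0 < enorm x by rewrite (lt_trans _ M1)// invr_gt0.
set s := dotv x x; have s0 : 0 <= s := sq_ge0 x.
have cs : cut b < s.
  by rewrite -[s]sqr_sqrtr// /cut ltr_pXn2r// ?nnegrE ?invr_ge0 ?ltW.
have G0 := ratio_gt0 b0 s0.
have hE : enorm (radial_h b x) = ratio b s * enorm x.
  by rewrite radial_hE// enormZ// ltW.
have hR : R0 < enorm (radial_h b x).
  rewrite hE (le_lt_trans (ler_norm _))// (lt_le_trans M2)// mulrC ler_pM2r//.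
  exact: ratio_ge.
rewrite radial_derivative_ln_transformed//.
apply: (@light_numeric b alpha n%:R (enorm x) (expR (b * enorm x)) e) => //.
- by rewrite /e ltr_expR mulrC -ltr_pdivrMr// div1r.
- by rewrite natr1.
- by rewrite /ratio /glue cs.
- by rewrite /dratio /glue cs.
- by rewrite /slope /glue cs.
- by rewrite /dslope /glue cs.
- by rewrite -hE; exact: tail.
Qed.

End tail.

(** * The transformed density has mass one *)

Section line.
Context {R : realType}.
Variables (b w : R).
Hypotheses (b0 : 0 < b) (w0 : 0 < w).

(** The map [h] in the coordinate [t] of the line spanned by a vector [y] with
    [dotv y y = w]. *)
Definition line_map (t : R) : R := ratio b (t ^+ 2 * w) * t.

Lemma line_map_arg_ge0 t : 0 <= t ^+ 2 * w.
Proof. by rewrite mulr_ge0 ?sqr_ge0 ?ltW. Qed.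

Lemma is_derive_line_map (t : R) : is_derive t 1 line_map (slope b (t ^+ 2 * w)).
Proof.
have d1 : is_derive t 1 (fun x : R => x ^+ 2 * w) (2 * t * w).
  rewrite (_ : (fun x : R => _) = (id ^+ 2) * (cst w)); last first.
    by apply/funext => x; rewrite /= exprfctE.
  apply: is_derive_eq; rewrite /GRing.scale/= !exprfctE expr1; ring.
have d2 := @is_derive1_comp _ (ratio b) (fun x : R => x ^+ 2 * w) t _ _
   (is_derive_ratio b0 _) d1.
have := is_deriveM d2 (is_derive_id t (1 : R)).
by move=> dM; apply: is_derive_eq; rewrite slopeE//= /GRing.scale/=; ring.
Qed.

Lemma continuous_slope_line : continuous (fun t : R => slope b (t ^+ 2 * w)).
Proof.
move=> t; apply: (@continuous_comp _ _ _ (fun t : R => t ^+ 2 * w) (slope b)).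
  by apply: cvgM; [exact: exprn_continuous|exact: cvg_cst].
exact: continuous_slope.
Qed.

Lemma line_map_incr : {homo line_map : x y / x < y}.
Proof.
move=> x y xy.
have cq : continuous line_map := is_derive_continuous is_derive_line_map.
apply: (@gtr0_derive1_lt_cc _ line_map x y) => //; rewrite ?in_itv/= ?lexx ?ltW//.
- by move=> t _; have [] := is_derive_line_map t.
- move=> t _; rewrite derive1E; have [_ ->] := is_derive_line_map t.
  exact/slope_gt0/line_map_arg_ge0.
- exact: continuous_subspaceT.
Qed.

Let c : R := b * expR 1 / 2.
Let c0 : 0 < c. Proof. by rewrite divr_gt0// mulr_gt0// expR_gt0. Qed.

Lemma line_map_cvgy : line_map x @[x --> +oo] --> +oo.
Proof.
apply/cvgryPge => M; near=> x.
have x0 : 0 <= x by near: x; exact: nbhs_pinfty_ge.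
apply: (@le_trans _ _ (c * x)).
  rewrite mulrC -ler_pdivrMr//; near: x; exact: nbhs_pinfty_ge.
by rewrite ler_wpM2r// ratio_ge// line_map_arg_ge0.
Unshelve. all: by end_near. Qed.

Lemma line_map_cvgNy : line_map x @[x --> -oo] --> -oo.
Proof.
apply/cvgrNyPle => M; near=> x.
have x0 : x <= 0 by near: x; exact: nbhs_ninfty_le.
apply: (@le_trans _ _ (c * x)).
  by rewrite ler_wnM2r// ratio_ge// line_map_arg_ge0.
rewrite mulrC -ler_pdivlMr//; near: x; exact: nbhs_ninfty_le.
Unshelve. all: by end_near. Qed.

End line.

Section density.
Context {R : realType} {n : nat}.
Variable b : R.
Hypothesis b0 : 0 < b.
Notation mu := (@lebesgue_measure R).
Notation rn := (lebesgue_rn R).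
Notation h := (@radial_h R n.+1 b).

Lemma row_tscale (c : R) (x : n.+1.-tuple (measurableTypeR R)) :
  row_of_tuple (tscale c x) = c *: row_of_tuple x.
Proof. by apply/rowP => i; rewrite !mxE tnth_mktuple. Qed.

Lemma measurable_sq :
  measurable_fun [set: n.+1.-tuple (measurableTypeR R)]
    (fun x => dotv (row_of_tuple x) (row_of_tuple x) : measurableTypeR R).
Proof.
rewrite (_ : (fun x => _) = (fun x => \sum_(i < n.+1) (tnth x i * tnth x i : R))).
  apply: measurable_sum => i.
  by apply: measurable_funM; exact: measurable_tnth.
by apply/funext => x; apply: eq_bigr => i _; rewrite !mxE.
Qed.

(** On tuples, [h] is the rescaling by a measurable factor, which reduces the
    claim to the measurability of [p] itself. *)
Lemma measurable_transformed (p : 'rV[R]_n.+1 -> R) :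
  measurable_fun [set: n.+1.-tuple (measurableTypeR R)]
    (fun t => p (row_of_tuple t) : measurableTypeR R) ->
  measurable_fun [set: n.+1.-tuple (measurableTypeR R)]
    (fun t => transformed_density p h (row_of_tuple t) : measurableTypeR R).
Proof.
move=> mp.
have mphi (phi : R -> R) : continuous phi ->
  measurable_fun [set: n.+1.-tuple (measurableTypeR R)]
    (fun x => phi (dotv (row_of_tuple x) (row_of_tuple x)) : measurableTypeR R).
  move=> cphi; apply: (measurableT_comp _ measurable_sq).
  exact: continuous_measurable_fun.
rewrite (_ : (fun t => _) = fun t =>
  p (row_of_tuple (tscale (ratio b (dotv (row_of_tuple t) (row_of_tuple t))) t))
  * @weight R n b (dotv (row_of_tuple t) (row_of_tuple t))); last first.
  by apply/funext => t; rewrite transformed_densityE// row_tscale -radial_hE.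
apply: measurable_funM; last exact: mphi (continuous_weight b0).
apply: (measurableT_comp mp); apply: measurable_tscale => //.
exact: mphi (continuous_ratio b0).
Qed.

(** The factor [ratio ^+ n] of the Jacobian determinant turns the line density
    [`|t| ^+ n] into the one at the image point, and the remaining factor is
    the derivative of [line_map]. *)
Lemma integral_line_transformed (p : 'rV[R]_n.+1 -> R) (y : 'rV[R]_n.+1) :
  continuous p -> (forall x, 0 <= p x) -> 0 < dotv y y ->
  (\int[mu]_t (`|t| ^+ n * p (t *: y))%:E =
   \int[mu]_t (`|t| ^+ n * transformed_density p h (t *: y))%:E)%E.
Proof.
move=> cp p0 y0.
rewrite (ge0_integration_by_substitution_line (@line_map_incr _ _ _ b0 y0)
  (@is_derive_line_map _ _ _ b0) (continuous_slope_line b0)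
  (line_map_cvgNy b0 y0) (line_map_cvgy b0 y0)).
- apply: eq_integral => t _; congr EFin.
  rewrite transformed_densityE// radial_hE//.
  rewrite dotvZl dotvZr mulrA -expr2 scalerA -/(line_map b (dotv y y) t).
  rewrite /weight {1}/line_map normrM exprMn gtr0_norm ?ratio_gt0//; last first.
    by rewrite mulr_ge0 ?sqr_ge0 ?ltW.
  ring.
- move=> t; apply: cvgM.
    apply: (@continuous_comp _ _ _ (fun x : R => `|x|) (fun x => x ^+ n)).
      exact: norm_continuous.
    exact: exprn_continuous.
  apply: (@continuous_comp _ _ _ (fun x : R => x *: y) p); last exact: cp.
  exact: scalel_continuous.
- by move=> t; rewrite mulr_ge0.
Qed.

Lemma is_density_transformed (p : 'rV[R]_n.+1 -> R) :
  continuous p -> is_density p -> is_density (transformed_density p h).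
Proof.
move=> cp [mp p0 p1].
have t0 x : 0 <= transformed_density p h x by rewrite mulr_ge0.
have mt := measurable_transformed mp; split=> //.
have lines (f : 'rV[R]_n.+1 -> R) : (forall x, 0 <= f x) ->
    measurable_fun [set: n.+1.-tuple (measurableTypeR R)]
      (fun t => f (row_of_tuple t) : measurableTypeR R) ->
    (\int[rn n.+1]_x (f (row_of_tuple x))%:E =
     \int[rn n]_z \int[mu]_t
        (`|t| ^+ n * f (t *: row_of_tuple (affine_dir z)))%:E)%E.
  move=> f0 mf; rewrite ge0_integral_lines.
  - apply: eq_integral => z _; apply: eq_integral => t _.
    by rewrite EFinM -row_tscale.
  - exact/measurable_EFinP.
  - by move=> x; rewrite lee_fin.
rewrite -p1 (lines _ t0 mt) (lines _ p0 mp); apply: eq_integral => z _.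
apply/esym/integral_line_transformed => //.
rewrite /dotv big_ord_recl !mxE tnth0 mulr1 ltr_pwDl//.
by apply: sumr_ge0 => i _; rewrite -expr2 sqr_ge0.
Qed.

End density.

Unset Implicit Arguments.

Theorem theorem3 (R : realType) (k : nat) (pi_beta : 'rV[R]_k -> R)
    (alpha R0 b : R) :
  (1 <= k)%N ->
  positive_C1_density pi_beta ->
  sub_exponentially_light pi_beta ->
  k%:R < alpha ->
  (forall beta : 'rV[R]_k, R0 < enorm beta ->
     dotv (unitv beta) (grad (fun y => ln (pi_beta y)) beta) <= - (alpha / enorm beta)) ->
  0 < b ->
  positive_C1_density (transformed_density pi_beta (radial_h b)) /\
  exponentially_light (transformed_density pi_beta (radial_h b)).
Proof.
case: k pi_beta => [//|n] p _ [dens p0 cd] _ ka tail b0.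
have [dp _] := cd.
have cp : continuous p by move=> x; exact: differentiable_continuous.
split; last exact: exponentially_light_transformed ka tail b0.
split; first exact: is_density_transformed.
  by move=> x; rewrite transformed_densityE// mulr_gt0// weight_gt0// sq_ge0.
exact: cont_diff_transformed.
Qed.
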